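(* Let $0<\varepsilon<\frac{1}{2\sqrt2}$ and $M>0$, and let $E_0:\mathbb{R}^2\to\mathbb{R}$ and $r:[0,1]\to\mathbb{R}^2$ be the energy and curve defined in the context. Along $r$ the tangential quadratic form of the Hessian of $E_0$ is bounded and satisfies, for all $s\in[0,1]$, $$r'(s)^{\top}\operatorname{Hess}E_0(r(s))\,r'(s)=\frac{\mathrm d}{\mathrm ds}\bigl[\nabla E_0(r(s))\bigr]\cdot r'(s)=2\,\Gamma(\tfrac52)\,s\,(1-3s^2).$$ Moreover, the full Hessian matrix $\operatorname{Hess}E_0(r(s))$ has bounded entries on $[0,1]$. Consequently, $$\inf_{s\in[0,1]}\lambda_{\min}\bigl(\operatorname{Hess}E_0(r(s))\bigr)>-\infty,$$ where $\lambda_{\min}$ denotes the smallest eigenvalue of a symmetric matrix.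
   Context: The curve is $r(s)=(\varepsilon s,\ s-s^3)$ for $s\in[0,1]$. The energy: for $(x,y)\in\mathbb{R}^2$ put $\zeta=x/\varepsilon$, $\psi(x)=\zeta-\zeta^3$, $w=y-\psi(x)$, $\Phi(\zeta)=\Gamma(\frac32)-\Gamma(\frac52)\zeta^2$, and let $B:\mathbb{R}\to\mathbb{R}$ be the unique function with $B(0)=0$ and $B'(x)=-\varepsilon\Gamma(\frac32)-\Phi(x/\varepsilon)\,\psi'(x)$ (here $\psi'$ is the derivative with respect to $x$). Then $$E_0(x,y)=B(x)-\Phi(\zeta)\,w+\tfrac M2 w^2 .$$ *)

(* Defs.v *)
From HB Require Import structures.
From mathcomp Require Import all_boot all_order all_algebra.
From mathcomp Require Import all_classical all_reals all_analysis.
From mathcomp Require Import ring lra.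

Set Implicit Arguments.
Unset Strict Implicit.
Unset Printing Implicit Defensive.

Import Order.TTheory GRing.Theory Num.Theory.
Import numFieldNormedType.Exports.

Local Open Scope ring_scope.
Local Open Scope classical_set_scope.

Definition Gamma (R : realType) (a : R) : R :=
  \int[lebesgue_measure]_(t in `]0%R, +oo[) (t `^ (a - 1) * expR (- t)).

Definition grad (R : realType) (n : nat) (f : 'cV[R]_n -> R) (p : 'cV[R]_n) :
    'cV[R]_n :=
  \col_i 'D_(delta_mx i 0) f p.

Definition Hess (R : realType) (n : nat) (f : 'cV[R]_n -> R) (p : 'cV[R]_n) :
    'M[R]_n :=
  \matrix_(i, j) 'D_(delta_mx i 0) (fun q => 'D_(delta_mx j 0) f q) p.

(* Only meaningful for symmetric matrices: the set of real eigenvalues is then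
   finite and nonempty, so that the infimum is attained (see lambda_minP). *)
Definition lambda_min (R : realType) (n : nat) (A : 'M[R]_n) : R :=
  inf [set a | eigenvalue A a].

Definition psi (R : realType) (eps x : R) : R :=
  (x / eps) - (x / eps) ^+ 3.

Definition Phi (R : realType) (zeta : R) : R :=
  Gamma (3 / 2) - Gamma (5 / 2) * zeta ^+ 2.

Definition is_base (R : realType) (eps : R) (B : R -> R) : Prop :=
  B 0 = 0 /\
  forall x : R, is_derive x 1 B
    (- eps * Gamma (3 / 2) - Phi (x / eps) * derive1 (psi eps) x).

Definition E0 (R : realType) (eps M : R) (B : R -> R) (p : 'cV[R]_2) : R :=
  let x := p 0 0 in
  let y := p 1 0 in
  let w := y - psi eps x in
  B x - Phi (x / eps) * w + M / 2 * w ^+ 2.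

(* The polynomial formula is used on the whole line, so that derivatives at
   the endpoints of [0, 1] are two-sided. *)
Definition curve (R : realType) (eps s : R) : 'cV[R]_2 :=
  \col_i (if i == 0 then eps * s else s - s ^+ 3).

Lemma derive1_psi (R : realType) (eps x : R) :
  derive1 (psi eps) x = eps^-1 - 3 * (x / eps) ^+ 2 / eps.
Proof.
rewrite derive1E.
have -> : psi eps = (fun x => x / eps) - (fun x => (x / eps) ^+ 3).
  by apply/funext.
rewrite (@derive_val _ _ _ _ _ _ _ _) /GRing.scale /=.
ring.
Qed.

Lemma is_base_exists_unique (R : realType) (eps : R) :
  eps != 0 -> exists! B : R -> R, is_base eps B.
Proof.
move=> eps0.
pose g3 : R := Gamma (3 / 2).
pose g5 : R := Gamma (5 / 2).
pose B (x : R) : R := - (eps * g3 + g3 / eps) * x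
  + (3 * g3 + g5) / (3 * eps ^+ 3) * x ^+ 3 - 3 * g5 / (5 * eps ^+ 5) * x ^+ 5.
have hB : is_base eps B.
  split; first by rewrite /B; ring.
  move=> x; apply: is_derive_eq.
  rewrite derive1_psi /Phi -/g3 -/g5 /GRing.scale /=.
  by field.
exists B; split=> // C [C0 hC]; case: hB => B0 hB.
apply/funext => x.
have h (y : R) : is_derive y (1 : R) (B - C) 0.
  apply: (@is_derive_eq _ _ _ _ _ _ _ _ (is_deriveB (hB y) (hC y))).
  by rewrite subrr.
have := @is_derive_0_is_cst _ (B - C) x 0 h.
by rewrite !fctE B0 C0 subrr => /eqP; rewrite subr_eq0 => /eqP.
Qed.

Lemma lambda_minP (R : realType) (A : 'M[R]_2) : A^T = A ->
  eigenvalue A (lambda_min A) /\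
  forall a, eigenvalue A a -> lambda_min A <= a.
Proof.
move=> As.
have A10 : A 1 0 = A 0 1 by rewrite -{1}As mxE.
have evE a : eigenvalue A a = ((a - A 0 0) * (a - A 1 1) == A 0 1 ^+ 2).
  rewrite eigenvalue_root_char /root /char_poly.
  have -> : (\det (char_poly_mx A)).[a]
    = (a - A 0 0) * (a - A 1 1) - A 0 1 ^+ 2.
    rewrite (expand_det_row _ 0) !big_ord_recl big_ord0 /cofactor !det_mx11.
    rewrite !mxE /= !hornerE /=.
    have -> : lift 0 (0 : 'I_1) = 1 :> 'I_2 by apply/val_inj.
    have -> : lift 1 (0 : 'I_1) = 0 :> 'I_2 by apply/val_inj.
    rewrite A10 /=.
    by rewrite /bump /= ?hornerE /=; ring.
  by rewrite subr_eq0.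
set d := Num.sqrt ((A 0 0 - A 1 1) ^+ 2 + 4 * A 0 1 ^+ 2).
have d0 : 0 <= d by apply: sqrtr_ge0.
have dE : d ^+ 2 = (A 0 0 - A 1 1) ^+ 2 + 4 * A 0 1 ^+ 2.
  rewrite sqr_sqrtr //; apply: addr_ge0; first exact: sqr_ge0.
  by apply: mulr_ge0; [lra|exact: sqr_ge0].
set l := (A 0 0 + A 1 1 - d) / 2.
have evl : eigenvalue A l.
  rewrite evE; apply/eqP.
  have -> : (l - A 0 0) * (l - A 1 1) = (d ^+ 2 - (A 0 0 - A 1 1) ^+ 2) / 4.
    by rewrite /l; field.
  by rewrite dE; field.
have lmin a : eigenvalue A a -> l <= a.
  rewrite evE => /eqP ha; rewrite leNgt; apply/negP => al.
  have : (2 * a - (A 0 0 + A 1 1) - d) * (2 * a - (A 0 0 + A 1 1) + d) = 0.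
    rewrite -subr_sqr dE -ha; ring.
  apply/eqP; rewrite mulf_neq0 // lt_eqF //; move: al d0; rewrite /l.
    move: (A 0 0) (A 1 1) => x y; lra.
  move: (A 0 0) (A 1 1) => x y; lra.
suff -> : lambda_min A = l by [].
apply/eqP; rewrite eq_le; apply/andP; split.
- by apply: ge_inf => //; exists l => a; exact: lmin.
- by apply: lb_le_inf; [exists l|move=> a; exact: lmin].
Qed.

(* Main.v *)
Require Import Defs.
From HB Require Import structures.
From mathcomp Require Import all_boot all_order all_algebra.
From mathcomp Require Import all_classical all_reals all_analysis.
From mathcomp Require Import ring.

Set Implicit Arguments.
Unset Strict Implicit.
Unset Printing Implicit Defensive.

Import Order.TTheory GRing.Theory Num.Theory.
Import numFieldNormedType.Exports.

Local Open Scope ring_scope.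
Local Open Scope classical_set_scope.

(** Differentiating the energy in x, the choice of B' cancels Phi * psi', so
    that with w = y - psi x the gradient of E0 is
      ( - eps Gamma(3/2) - w (Phi' + M psi'),  M w - Phi ),
    where the prime denotes d/dx throughout ([is_grad2_E0]). The curve lies on
    the set w = 0, and there the gradient reduces to
      ( - eps Gamma(3/2),  - Gamma(3/2) + Gamma(5/2) s^2 ).
    Its derivative in s is (0, 2 Gamma(5/2) s), and pairing with
    r' = (eps, 1 - 3 s^2) gives 2 Gamma(5/2) s (1 - 3 s^2).

    Differentiating the gradient once more shows that E0 is twice
    differentiable with a symmetric Hessian, whose entries along the curve are
    polynomials in s ([Hess_E0_curve]); evaluating the quadratic form on r'
    gives the same value as above. Polynomials are bounded on the segment
    [0, 1]. Finally, every eigenvalue of an n by n matrix with entries bounded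
    by C has absolute value at most n C ([eigenvalue_norm_le]), and the smallest
    eigenvalue of a symmetric matrix is one of its eigenvalues, so it is bounded
    below uniformly in s. *)

(** * Eigenvalue and boundedness estimates *)

(** A row eigenvector v gives a * v_j = sum_i v_i A_ij; summing the absolute
    values over j and dividing by the l^1-norm of v yields the bound. *)
Lemma eigenvalue_norm_le (R : realType) (n : nat) (A : 'M[R]_n) (C a : R) :
  (forall i j, `|A i j| <= C) -> eigenvalue A a -> `|a| <= n%:R * C.
Proof.
move=> AC /eigenvalueP[v vA v0].
have S0 : 0 < \sum_i `|v 0 i|.
  rewrite lt_neqAle sumr_ge0 // andbT eq_sym; apply: contra v0.
  rewrite psumr_eq0 // => /allP h; apply/eqP/rowP => i.
  by rewrite mxE; apply/eqP; rewrite -normr_eq0; apply: h; rewrite mem_index_enum.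
rewrite -(ler_pM2r S0) mulr_sumr.
have le j : `|a| * `|v 0 j| <= \sum_i `|v 0 i| * C.
  rewrite -normrM; have -> : a * v 0 j = (v *m A) 0 j by rewrite vA mxE.
  rewrite mxE; apply: le_trans (ler_norm_sum _ _ _) _.
  by apply: ler_sum => i _; rewrite normrM ler_wpM2l.
apply: le_trans (ler_sum _ (fun j _ => le j)) _.
by rewrite sumr_const card_ord -mulr_suml -mulrA [C * _]mulrC mulr_natl.
Qed.

(** There are finitely many entries, so their bounds can be made common; this
    is the form in which [eigenvalue_norm_le] consumes them. *)
Lemma bounded_entries (R : realType) (n : nat) (A : R -> 'M[R]_n) (S : set R) :
  (forall i j, [bounded A s i j | s in S]) ->
  exists C, forall s, S s -> forall i j, `|A s i j| <= C.
Proof.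
move=> bA.
have bA' : \forall C \near +oo, forall i j, S `<=` [set s | `|A s i j| <= C].
  by apply: filter_forall => i; apply: filter_forall => j; exact: bA.
have [C hC] := filter_ex bA'.
by exists C => s Ss i j; exact: hC.
Qed.

Lemma ord2_cases (i : 'I_2) : i = 0 \/ i = 1.
Proof. by case: i => [[|[|//]] lt_i]; [left|right]; apply/val_inj. Qed.

Lemma is_derive_col (R : realType) (n : nat) (f : 'I_n -> R -> R)
    (df : 'I_n -> R) (s : R) :
  (forall i, is_derive s 1 (f i) (df i)) ->
  is_derive s 1 (fun t => \col_i f i t) (\col_i df i).
Proof.
move=> hf.
have fE i j : (fun t => (\col_i f i t) i j) = f i.
  by apply/funext => t; rewrite mxE.
have drv : derivable (fun t => \col_i f i t) s 1.
  by apply/derivable_mxP => i j; rewrite fE; case: (hf i).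
apply: DeriveDef => //; rewrite derive_mx //; apply/matrixP => i j.
by rewrite !mxE fE derive_val.
Qed.

(** Differentiability gives continuity, and the segment is compact. *)
Lemma derivable_bounded_segment (R : realType) (f : R -> R) (a b : R) :
  (forall s : R, derivable f s 1) ->
  [bounded f s | s in `[a, b]%classic].
Proof.
move=> hf.
have cf : {within `[a, b], continuous f}.
  by apply: derivable_within_continuous => x _; exact: hf.
have [M [Mr hM]] := compact_bounded (continuous_compact cf (@segment_compact _ a b)).
by exists M; split => // N MN s sab /=; apply: hM => //; exists s.
Qed.

(** * Gradients of functions of two variables *)

(** The differential of f at p is given by the row (a, b). Recording Frechet
    differentiability together with both partial derivatives lets one
    computation produce the differentiability claims and the values of grad and
    Hess at the same time. *)
Definition is_grad2 (R : realType) (f : 'cV[R]_2 -> R) (p : 'cV[R]_2)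
    (a b : R) : Prop :=
  is_diff p f (fun v : 'cV[R]_2 => a * v 0 0 + b * v 1 0).

Lemma is_grad2_differentiable (R : realType) (f : 'cV[R]_2 -> R) p a b :
  is_grad2 f p a b -> differentiable f p.
Proof. by case. Qed.

Lemma is_grad2_derive0 (R : realType) (f : 'cV[R]_2 -> R) p a b :
  is_grad2 f p a b -> 'D_(delta_mx 0 0) f p = a.
Proof.
by case=> df dv; rewrite deriveE // dv !mxE /= mulr1 mulr0 addr0.
Qed.

Lemma is_grad2_derive1 (R : realType) (f : 'cV[R]_2 -> R) p a b :
  is_grad2 f p a b -> 'D_(delta_mx 1 0) f p = b.
Proof.
by case=> df dv; rewrite deriveE // dv !mxE /= mulr1 mulr0 add0r.
Qed.

Lemma is_grad2_eq (R : realType) (f : 'cV[R]_2 -> R) p a b a' b' :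
  is_grad2 f p a' b' -> a' = a -> b' = b -> is_grad2 f p a b.
Proof. by move=> h <- <-. Qed.

Lemma is_diff_coord (R : realType) (m n : nat) (p : 'M[R]_(m, n)) i j :
  is_diff p (fun q => q i j : R) (fun v => v i j).
Proof.
have cl : linear (fun N : 'M[R]_(m, n) => N i j : R).
  by move=> k u v; rewrite !mxE.
pose LM := GRing.isLinear.Build _ _ _ _ _ cl.
pose L : {linear 'M[R]_(m, n) -> R} := HB.pack (fun N : 'M[R]_(m, n) => N i j : R) LM.
split; first exact: differentiable_coord.
by rewrite (_ : (fun q : 'M[R]_(m, n) => q i j : R) = L) // diff_lin //;
  exact: coord_continuous.
Qed.

(** Functions of the first coordinate alone are the only place where the chain
    rule is used: B, psi and Phi all enter the energy in this way. *)
Lemma is_grad2_fst (R : realType) (g : R -> R) (dg : R) (p : 'cV[R]_2) :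
  is_derive (p 0 0) 1 g dg -> is_grad2 (fun q => g (q 0 0)) p dg 0.
Proof.
move=> [gd gv].
have gdiff : is_diff (p 0 0) g (fun h => h *: dg).
  by split; [exact/derivable1_diffP | rewrite deriv1E // derive1E gv].
apply: is_diff_eq; first exact: (is_diff_comp (is_diff_coord p 0 0) gdiff).
by apply/funext => v /=; rewrite mul0r addr0 mulrC.
Qed.

Lemma is_grad2_snd (R : realType) (p : 'cV[R]_2) :
  is_grad2 (fun q => q 1 0) p 0 1.
Proof.
apply: is_diff_eq; first exact: is_diff_coord.
by apply/funext => v /=; rewrite mul0r add0r mul1r.
Qed.

Lemma is_grad2D (R : realType) (f g : 'cV[R]_2 -> R) p a b c d :
  is_grad2 f p a b -> is_grad2 g p c d ->
  is_grad2 (fun q => f q + g q) p (a + c) (b + d).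
Proof.
move=> hf hg; apply: is_diff_eq; first exact: (is_diffD hf hg).
by apply/funext => v /=; rewrite !fctE; ring.
Qed.

Lemma is_grad2B (R : realType) (f g : 'cV[R]_2 -> R) p a b c d :
  is_grad2 f p a b -> is_grad2 g p c d ->
  is_grad2 (fun q => f q - g q) p (a - c) (b - d).
Proof.
move=> hf hg; apply: is_diff_eq; first exact: (is_diffB hf hg).
by apply/funext => v /=; rewrite !fctE; ring.
Qed.

Lemma is_grad2M (R : realType) (f g : 'cV[R]_2 -> R) p a b c d :
  is_grad2 f p a b -> is_grad2 g p c d ->
  is_grad2 (fun q => f q * g q) p (f p * c + g p * a) (f p * d + g p * b).
Proof.
move=> hf hg; apply: is_diff_eq; first exact: (is_diffM hf hg).
by apply/funext => v /=; rewrite !fctE /GRing.scale /=; ring.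
Qed.

(** * The energy and its restriction to the curve *)

Section energy.
Variables (R : realType) (eps M : R) (B : R -> R).
Hypotheses (eps0 : eps != 0) (hB : is_base eps B).

Let g3 : R := Gamma (3 / 2).
Let g5 : R := Gamma (5 / 2).
Let dpsi (x : R) : R := eps^-1 - 3 * (x / eps) ^+ 2 / eps.
Let dPhi (x : R) : R := - (2 * g5 * x / eps ^+ 2).
Let w (p : 'cV[R]_2) : R := p 1 0 - psi eps (p 0 0).

Lemma is_derive_psi (x : R) : is_derive x 1 (psi eps) (dpsi x).
Proof.
have -> : psi eps = (fun x => x / eps) - (fun x => (x / eps) ^+ 3).
  by apply/funext.
by apply: is_derive_eq; rewrite /dpsi /GRing.scale /=; ring.
Qed.

Lemma is_derive_dpsi (x : R) : is_derive x 1 dpsi (- (6 * x / eps ^+ 3)).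
Proof. by apply: is_derive_eq; rewrite /GRing.scale /=; field. Qed.

Lemma is_derive_Phi (x : R) : is_derive x 1 (fun x => Phi (x / eps)) (dPhi x).
Proof.
by rewrite /Phi; apply: is_derive_eq; rewrite /dPhi /GRing.scale /= -/g5; field.
Qed.

Lemma is_derive_dPhi (x : R) : is_derive x 1 dPhi (- (2 * g5 / eps ^+ 2)).
Proof. by apply: is_derive_eq; rewrite /GRing.scale /=; field. Qed.

Lemma is_grad2_w p : is_grad2 w p (- dpsi (p 0 0)) 1.
Proof.
apply: is_grad2_eq.
- exact: is_grad2B (is_grad2_snd p) (is_grad2_fst (is_derive_psi (p 0 0))).
- by rewrite sub0r.
- by rewrite subr0.
Qed.

(** The definition of B is made for this cancellation: the term
    - Phi * psi' of B' removes the contribution Phi * psi' which comes from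
    differentiating - Phi * w in the x-direction. Hence B no longer occurs, and
    apart from the constant - eps * Gamma (3/2) the first component is a
    multiple of w. *)
Lemma is_grad2_E0 p : is_grad2 (E0 eps M B) p
  (- eps * g3 - w p * (dPhi (p 0 0) + M * dpsi (p 0 0)))
  (M * w p - Phi (p 0 0 / eps)).
Proof.
have hB1 := is_grad2_fst (hB.2 (p 0 0)).
have hw := is_grad2_w p.
have hP := is_grad2_fst (is_derive_Phi (p 0 0)).
have hM := is_grad2_fst (is_derive_cst (M / 2 : R) (p 0 0 : R) (1 : R)).
apply: is_grad2_eq.
- exact: is_grad2D (is_grad2B hB1 (is_grad2M hP hw))
    (is_grad2M hM (is_grad2M hw hw)).
- by rewrite derive1_psi -/(dpsi _) /cst /= -/g3; field.
- by rewrite /cst /=; field.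
Qed.

Lemma is_grad2_D0E0 p : is_grad2 (fun q => 'D_(delta_mx 0 0) (E0 eps M B) q) p
  (dpsi (p 0 0) * (dPhi (p 0 0) + M * dpsi (p 0 0))
    + w p * (2 * g5 / eps ^+ 2 + 6 * M * p 0 0 / eps ^+ 3))
  (- (dPhi (p 0 0) + M * dpsi (p 0 0))).
Proof.
have -> : (fun q => 'D_(delta_mx 0 0) (E0 eps M B) q) =
    fun q => - eps * g3 - w q * (dPhi (q 0 0) + M * dpsi (q 0 0)).
  by apply/funext => q; exact: is_grad2_derive0 (is_grad2_E0 q).
have hc := is_grad2_fst (is_derive_cst (- eps * g3 : R) (p 0 0 : R) (1 : R)).
have hM := is_grad2_fst (is_derive_cst (M : R) (p 0 0 : R) (1 : R)).
have hw := is_grad2_w p.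
have hP := is_grad2_fst (is_derive_dPhi (p 0 0)).
have hp := is_grad2_fst (is_derive_dpsi (p 0 0)).
apply: is_grad2_eq.
- exact: is_grad2B hc (is_grad2M hw (is_grad2D hP (is_grad2M hM hp))).
- by rewrite /cst /=; field.
- by rewrite /cst /=; field.
Qed.

Lemma is_grad2_D1E0 p : is_grad2 (fun q => 'D_(delta_mx 1 0) (E0 eps M B) q) p
  (- (dPhi (p 0 0) + M * dpsi (p 0 0))) M.
Proof.
have -> : (fun q => 'D_(delta_mx 1 0) (E0 eps M B) q) =
    fun q => M * w q - Phi (q 0 0 / eps).
  by apply/funext => q; exact: is_grad2_derive1 (is_grad2_E0 q).
have hM := is_grad2_fst (is_derive_cst (M : R) (p 0 0 : R) (1 : R)).
have hw := is_grad2_w p.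
have hP := is_grad2_fst (is_derive_Phi (p 0 0)).
apply: is_grad2_eq.
- exact: is_grad2B (is_grad2M hM hw) hP.
- by rewrite /cst /=; ring.
- by rewrite /cst /=; ring.
Qed.

Lemma is_derive_curve (s : R) :
  is_derive s 1 (curve eps) (\col_i (if i == 0 then eps else 1 - 3 * s ^+ 2)).
Proof.
apply: is_derive_col => i; case: (i == 0).
  by apply: is_derive_eq; rewrite /GRing.scale /= mulr1.
by apply: is_derive_eq; rewrite /GRing.scale /=; ring.
Qed.

(** The curve is the graph y = psi x, which is why every term carrying a factor
    w can be dropped along it. *)
Lemma w_curve s : w (curve eps s) = 0.
Proof. by rewrite /w /psi !mxE /= mulrC mulKf // subrr. Qed.

(** The first component is constant along the curve, so that only the second
    one contributes to the derivative in [is_derive_grad_E0_curve]. *)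
Lemma grad_E0_curve s : grad (E0 eps M B) (curve eps s) =
  \col_i (if i == 0 then - eps * g3 else g5 * s ^+ 2 - g3).
Proof.
apply/matrixP => i j; rewrite !mxE.
case: (ord2_cases i) => -> /=.
  by rewrite (is_grad2_derive0 (is_grad2_E0 _)) w_curve mul0r subr0.
rewrite (is_grad2_derive1 (is_grad2_E0 _)) w_curve !mxE /= /Phi -/g3 -/g5.
by field.
Qed.

Lemma is_derive_grad_E0_curve (s : R) :
  is_derive s 1 (fun t => grad (E0 eps M B) (curve eps t))
    (\col_i (if i == 0 then 0 else 2 * g5 * s)).
Proof.
under [fun t => grad _ _]funext do rewrite grad_E0_curve.
apply: is_derive_col => i; case: (i == 0); first exact: is_derive_cst.
by apply: is_derive_eq; rewrite /GRing.scale /=; ring.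
Qed.

(** M * psi' + (d/dx) Phi (x / eps) at x = eps * s, the opposite of the mixed
    second derivative of the energy. *)
Let kappa (s : R) : R := (M * (1 - 3 * s ^+ 2) - 2 * g5 * s) / eps.

(** The entries are polynomials in s: this one formula yields the tangential
    form, the symmetry and the bounds. *)
Lemma Hess_E0_curve s : Hess (E0 eps M B) (curve eps s) =
  \matrix_(i, j) (if i == 0
    then if j == 0 then (1 - 3 * s ^+ 2) / eps * kappa s else - kappa s
    else if j == 0 then - kappa s else M).
Proof.
apply/matrixP => i j; rewrite !mxE.
case: (ord2_cases i) => ->; case: (ord2_cases j) => -> /=.
- rewrite (is_grad2_derive0 (is_grad2_D0E0 _)) w_curve !mxE /= /kappa /dPhi /dpsi.
  by field.
- rewrite (is_grad2_derive0 (is_grad2_D1E0 _)) !mxE /= /kappa /dPhi /dpsi.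
  by field.
- rewrite (is_grad2_derive1 (is_grad2_D0E0 _)) !mxE /= /kappa /dPhi /dpsi.
  by field.
- exact: (is_grad2_derive1 (is_grad2_D1E0 _)).
Qed.

Lemma Hess_E0_curve_bounded i j :
  [bounded Hess (E0 eps M B) (curve eps s) i j | s in `[0, 1]%classic].
Proof.
under [fun s => Hess _ _ _ _]funext do rewrite Hess_E0_curve mxE.
apply: derivable_bounded_segment => s; rewrite /kappa.
by case: (i == 0); case: (j == 0); apply: ex_derive.
Qed.

End energy.

(** * The theorem *)

Theorem lemma3p1 (R : realType) (eps M : R) (B : R -> R)
    (heps0 : 0 < eps) (heps : eps < 1 / (2 * Num.sqrt 2)) (hM : 0 < M)
    (hB : is_base eps B) :
  let E := E0 eps M B in
  let r := curve eps in
  let H := fun s : R => Hess E (r s) in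
  let Q := fun s : R => (((derive1 r s)^T *m H s *m derive1 r s) 0 0 : R) in
  (* E is twice differentiable and r is differentiable, so that no derivative
     below is a default value *)
  [/\ forall p : 'cV[R]_2, differentiable E p,
      forall (p : 'cV[R]_2) (j : 'I_2),
        differentiable (fun q : 'cV[R]_2 => 'D_(delta_mx j 0) E q : R) p,
      forall s : R, derivable r s 1 &
      forall s : R, derivable (fun t : R => grad E (r t)) s 1] /\
  [/\ [bounded Q s | s in `[0%R, 1%R]%classic],
      forall s : R, 0 <= s <= 1 ->
        Q s = ((derive1 (fun t : R => grad E (r t)) s)^T *m derive1 r s) 0 0 /\
        Q s = 2 * Gamma (5 / 2) * s * (1 - 3 * s ^+ 2),
      forall i j : 'I_2, [bounded H s i j | s in `[0%R, 1%R]%classic],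
      forall s : R, 0 <= s <= 1 -> (H s)^T = H s &
      (-oo < ereal_inf [set (lambda_min (H s))%:E | s in `[0%R, 1%R]%classic])%E].
Proof.
move=> E r H Q.
have eps0 : eps != 0 by rewrite gt_eqF.
have r' s : derive1 r s = \col_i (if i == 0 then eps else 1 - 3 * s ^+ 2).
  by rewrite derive1E; case: (is_derive_curve eps s).
have gr' s := is_derive_grad_E0_curve M eps0 hB s.
have QE s : Q s = 2 * Gamma (5 / 2) * s * (1 - 3 * s ^+ 2).
  rewrite /Q r' /H Hess_E0_curve // !mxE !big_ord_recl big_ord0 !mxE /=.
  by rewrite !big_ord_recl !big_ord0 !mxE /=; field.
have Hsym s : (H s)^T = H s.
  rewrite /H Hess_E0_curve //; apply/matrixP => i j; rewrite !mxE.
  by case: (i == 0); case: (j == 0).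
have Hbnd := Hess_E0_curve_bounded M eps0 hB.
split; split.
- by move=> p; exact: is_grad2_differentiable (is_grad2_E0 M eps0 hB p).
- move=> p j; case: (ord2_cases j) => ->.
  + exact: is_grad2_differentiable (is_grad2_D0E0 M eps0 hB p).
  + exact: is_grad2_differentiable (is_grad2_D1E0 M eps0 hB p).
- by move=> s; case: (is_derive_curve eps s).
- by move=> s; case: (gr' s).
- under [fun s => Q s]funext do rewrite QE.
  by apply: derivable_bounded_segment => s; apply: ex_derive.
- move=> s _; rewrite QE; split=> //.
  rewrite derive1E derive_val r' !mxE !big_ord_recl big_ord0 !mxE /=.
  by ring.
- exact: Hbnd.
- by move=> s _; exact: Hsym.
(* By symmetry lambda_min is a genuine eigenvalue, hence at least - 2 C when
   the entries are at most C in absolute value. *)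
- have [C hC] := bounded_entries Hbnd.
  apply: (@lt_le_trans _ _ (- (2%:R * C))%:E); first exact: ltNyr.
  apply: le_ereal_inf_tmp => _ [s s01 <-]; rewrite lee_fin lerNl.
  have [lam _] := lambda_minP (Hsym s).
  apply: le_trans (ler_norm _) _; rewrite normrN.
  by apply: eigenvalue_norm_le lam => i j; exact: hC.
Qed.
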